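(* Let $0<r\le 1$ and let $d\ge 1$ be a fixed integer. Let $n$ tend to infinity through positive integers with $nr\in\mathbb{Z}$ (so that $(n-d)\to\infty$). Then the asymptotic Hamming distance spectrum $\psi(d)=\lim_{n\to\infty}\psi(d;n)$ of the rate-$r$ overlapped arithmetic code is given by $$\psi(d)=2^{-d}\sum_{b^d\in\{0,1\}^d}\ \sum_{1\le j_1<j_2<\cdots<j_d<\infty}\bigl(1-|\tau(j^d,b^d)|\bigr)^+ ,$$ as an identity in $[0,\infty]$.
   Context: Write $(t)^+=\max(0,t)$. For $x^n=(x_1,\dots,x_n)\in\{0,1\}^n$ let $\ell(x^n)=(1-2^{-r})\sum_{i=1}^n x_i2^{ir}\in[0,2^{nr}-1]$ and $m(x^n)=\lceil \ell(x^n)\rceil$. The rate-$r$, length-$n$ (tailless) overlapped arithmetic code partitions $\{0,1\}^n$ into the cosets $\mathcal C_m=\{x^n: m(x^n)=m\}$, $0\le m<2^{nr}$. For $x^n\in\{0,1\}^n$ and $0\le d\le n$ let $k(x^n,d)$ be the number of $y^n\in\{0,1\}^n$ with $m(y^n)=m(x^n)$ and with Hamming distance between $x^n$ and $y^n$ equal to $d$. The Hamming distance spectrum (HDS) for a uniform binary source is $\psi(d;n)=2^{-n}\sum_{x^n\in\{0,1\}^n}k(x^n,d)$, and the asymptotic HDS is $\psi(d)=\lim_{n\to\infty}\psi(d;n)$. For $j^d=\{j_1<\cdots<j_d\}$ a set of positive integers and $b^d=(b_1,\dots,b_d)\in\{0,1\}^d$, the shift function is $\tau(j^d,b^d)=(1-2^{-r})\sum_{d'=1}^{d}(1-2b_{d'})2^{rj_{d'}}$.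 *)

(* Defs.v *)
From HB Require Import structures.
From mathcomp Require Import all_boot all_order all_algebra.
From mathcomp Require Import all_classical all_reals all_analysis.
Set Implicit Arguments.
Unset Strict Implicit.
Unset Printing Implicit Defensive.
Import Order.TTheory GRing.Theory Num.Theory.
Import numFieldNormedType.Exports.
Local Open Scope classical_set_scope.
Local Open Scope ring_scope.

(* Words and index tuples are numbered from 1 on paper and from 0 here: the
   bit x_i is [x (i - 1)], hence the exponent [i.+1%:R * r]. *)
Definition oac_ell (R : realType) (r : R) (n : nat)
    (x : {ffun 'I_n -> bool}) : R :=
  (1 - 2 `^ (- r)) * \sum_(i < n) (x i)%:R * 2 `^ (i.+1%:R * r).

Definition oac_m (R : realType) (r : R) (n : nat)
    (x : {ffun 'I_n -> bool}) : int :=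
  Num.ceil (oac_ell r x).

Definition hamming (n : nat) (x y : {ffun 'I_n -> bool}) : nat :=
  #|[set i : 'I_n | x i != y i]%SET|.

Definition oac_k (R : realType) (r : R) (n : nat)
    (x : {ffun 'I_n -> bool}) (d : nat) : nat :=
  #|[set y : {ffun 'I_n -> bool} |
      (oac_m r y == oac_m r x) && (hamming x y == d)]%SET|.

Definition hds (R : realType) (r : R) (d n : nat) : R :=
  2 ^- n * \sum_(x : {ffun 'I_n -> bool}) (oac_k r x d)%:R.

Definition pos_part (R : realType) (t : R) : R := Num.max 0 t.

(* The indices j_1, ..., j_d themselves are positive integers, not shifted. *)
Definition pos_increasing (d : nat) : set {ffun 'I_d -> nat} :=
  [set j | (forall a, (0 < j a)%N) /\
           (forall a b : 'I_d, (a < b)%N -> (j a < j b)%N)].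
Arguments pos_increasing d : clear implicits.

Definition shift_tau (R : realType) (r : R) (d : nat)
    (j : {ffun 'I_d -> nat}) (b : {ffun 'I_d -> bool}) : R :=
  (1 - 2 `^ (- r)) * \sum_(a < d) (1 - 2 * (b a)%:R) * 2 `^ (r * (j a)%:R).

(* [is_asymptotic_hds r d l] says that the limit defining psi(d) exists in
   [-oo, +oo] and equals [l]; it is taken along the [n] with [n * r] an integer,
   which form a cofinal set exactly when [r] is rational. *)
Definition is_asymptotic_hds (R : realType) (r : R) (d : nat) (l : \bar R) :
    Prop :=
  (hds r d n)%:E @[n --> within [set n : nat | n%:R * r \is a Num.int] \oo]
    --> l.

(* Main.v *)
Require Import Defs.
From HB Require Import structures.
From mathcomp Require Import all_boot all_order all_algebra.
From mathcomp Require Import all_classical all_reals all_analysis.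
From mathcomp Require Import complex ring lra zify.

(* Flipping the bits of [x] at positions [j_1 < ... < j_d] shifts [l(x)] by
   [tau(j, b)], where [b] lists the flipped bits, and leaves the coset unchanged
   only if [|tau| < 1].  For rational [r = p / q] put [y = 2^r], so that
   [y^q = 2^p].  Signed sums of distinct powers of [y] never vanish, and even
   dominate a fixed fraction of their largest term, so [|tau(j, b)| < 1] holds for
   finitely many [j] only: all sums involved are finite and the limit can be taken
   term by term.  With the flipped bits frozen, [l(x)] is a sum of independent bits
   weighted by [(y - 1) y^i].  For [r < 1] it equidistributes modulo 1 by Weyl's
   criterion, because [y] is irrational and the weights of index [q k] are
   [2^(p k) (y - 1)]; the ceilings of [l] and [l + tau] then agree with limiting
   probability [1 - |tau|].  For [r = 1] every [tau] is a nonzero integer.  For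
   irrational [r] no [n > 0] qualifies and the limit is vacuous. *)
Set Implicit Arguments.
Unset Strict Implicit.
Unset Printing Implicit Defensive.
Import Order.TTheory GRing.Theory Num.Theory.
Import numFieldNormedType.Exports.
Local Open Scope classical_set_scope.
Local Open Scope ring_scope.

(** * Signed sums of powers of a root of 2^p *)

(** Multiplying a monic integral equation at 1/2 by a power of 2 makes its leading term 1 and all
    other terms even, a parity contradiction. *)
Lemma half_not_integral (R : realType) :
  ~ integralOver (intr : int -> R) (2^-1 : R).
Proof.
move=> [p pmon /rootP p0].
have p_neq0 : p != 0 by apply: monic_neq0.
have szp : (0 < size p)%N by rewrite size_poly_gt0.
have : \sum_(i < size p) (p`_i)%:~R * 2 ^+ ((size p).-1 - i) = 0 :> R.
  transitivity (2 ^+ (size p).-1 * (map_poly intr p).[2^-1] : R); last first.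
    by rewrite p0 mulr0.
  rewrite (horner_coef_wide _ (size_poly _ _)) mulr_sumr.
  apply: eq_bigr => i _; rewrite coef_map_id0 // mulrCA; congr (_ * _).
  have il : (i <= (size p).-1)%N by rewrite -ltnS prednK.
  by rewrite -{2}(subnK il) exprD -mulrA exprVn mulfV ?mulr1// expf_neq0 // pnatr_eq0.
rewrite -(prednK szp) big_ord_recr /= subnn expr0 mulr1.
move/monicP : pmon; rewrite /lead_coef => -> /= h.
have {}h : \sum_(i < (size p).-1) p`_i * 2 ^+ ((size p).-1 - i) + 1 = 0 :> int.
  apply/eqP; rewrite -(eqr_int R) rmorphD /= rmorph_sum /= -[X in _ == X]h.
  apply/eqP; congr (_ + _); apply: eq_bigr => i _.
  by rewrite rmorphM /= rmorphXn.
have : (2 %| \sum_(i < (size p).-1) p`_i * 2 ^+ ((size p).-1 - i))%Z.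
  apply: rpred_sum => i _; apply: dvdz_mull.
  by rewrite -subnSK // exprS; exact: dvdz_mulr.
move: h; set S := \sum_(i < _) _ => h /dvdzP[k kE].
by move: h; rewrite kE; lia.
Qed.

Lemma bernoulli_ge (R : realType) (y : R) n : 0 <= y -> 1 + n%:R * y <= (1 + y) ^+ n.
Proof.
move=> y0; elim: n => [|n IH]; first by rewrite mul0r addr0 expr0.
rewrite exprS; apply: (le_trans _ (ler_wpM2l _ IH)); last by rewrite addr_ge0.
by rewrite -natr1; have : 0 <= n%:R :> R by []; nra.
Qed.

Lemma expr_unbounded (R : realType) (x C : R) : 1 < x -> exists n, C <= x ^+ n.
Proof.
move=> x1; exists (Num.truncn (C / (x - 1))).+1.
have xB : 0 < x - 1 by rewrite subr_gt0.
have := bernoulli_ge (Num.truncn (C / (x - 1))).+1 (ltW xB).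
rewrite (addrC 1 (x - 1)) subrK; apply: le_trans.
have := truncnS_gt (C / (x - 1)).
by rewrite ltr_pdivrMr // => /ltW h; rewrite (le_trans h)// lerDr.
Qed.

Section PowersOfRoot.
Variables (R : realType) (x : R) (p q : nat).
Hypotheses (x_gt1 : 1 < x) (p_gt0 : (0 < p)%N) (q_gt0 : (0 < q)%N).
Hypothesis xq : x ^+ q = 2 ^+ p.

Let x_gt0 : 0 < x. Proof. exact: lt_trans x_gt1. Qed.

Lemma root_integral : integralOver (intr : int -> R) x.
Proof.
exists ('X^q - (2 ^+ p)%:P); first exact: monicXnsubC.
rewrite /root rmorphB /= map_polyXn map_polyC /= hornerD hornerN hornerXn hornerC.
by rewrite xq rmorphXn subrr.
Qed.

Lemma integral_exprn (y : R) n :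
  integralOver (intr : int -> R) y -> integralOver (intr : int -> R) (y ^+ n).
Proof.
move=> iy; elim: n => [|n IH]; first exact: mxpoly.integral1.
by rewrite exprS; exact: integral_mul.
Qed.

Lemma integral_sign (y : R) (b : bool) :
  integralOver (intr : int -> R) y ->
  integralOver (intr : int -> R) ((-1) ^+ b * y).
Proof.
move=> iy; apply: integral_mul iy.
by case: b; [exact/integral_opp/mxpoly.integral1|exact: mxpoly.integral1].
Qed.

Lemma integral_bigsum (I : finType) (F : I -> R) :
  (forall i, integralOver (intr : int -> R) (F i)) ->
  integralOver (intr : int -> R) (\sum_i F i).
Proof.
move=> iF; apply: (@big_ind _ (integralOver _)) => //; first exact: mxpoly.integral0.
by move=> *; exact: integral_add.
Qed.

(* If [x * w = ±1] with [w] in [Z[x]] then [2^-p = ± w^q] is an algebraic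
   integer; this replaces a 2-adic valuation on the field of [x]. *)
Lemma root_not_unit (w : R) (b : bool) :
  integralOver (intr : int -> R) w -> (-1) ^+ b + x * w != 0.
Proof.
move=> iw; apply/eqP => /eqP; rewrite addr_eq0 => /eqP h.
apply: (half_not_integral (R := R)).
have : 2 ^+ p * w ^+ q = (-1) ^+ (b.+1 * q)%N.
  by rewrite -xq -exprMn exprM exprS mulN1r h opprK.
move=> h2.
have -> : 2^-1 = 2 ^+ p.-1 * ((-1) ^+ (b.+1 * q) * w ^+ q) :> R.
  have : 2 * (2 ^+ p.-1 * ((-1) ^+ (b.+1 * q) * w ^+ q)) = 1 :> R.
    rewrite mulrA -exprS prednK // mulrCA h2 -signr_odd -expr2 sqrr_sign //.
  by move=> /(canRL (mulKf _)) -> //; rewrite mulr1.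
apply: integral_mul; first by rewrite -natrX; exact: integral_nat.
by rewrite -signr_odd; apply: integral_sign; exact: integral_exprn.
Qed.

(** Once the lowest power is factored out, a sign plus [x] times an algebraic integer remains, and
    [root_not_unit] applies. *)
Lemma signed_sum_neq0 k (j : 'I_k.+1 -> nat) (s : 'I_k.+1 -> bool) :
  {homo j : a b / (a < b)%N} -> \sum_a (-1) ^+ (s a) * x ^+ (j a) != 0.
Proof.
move=> jlt; rewrite big_ord_recl.
set w : R := \sum_(a < k) (-1) ^+ s (lift ord0 a) * x ^+ (j (lift ord0 a) - (j ord0).+1).
have -> : (-1) ^+ s ord0 * x ^+ j ord0 +
    \sum_(i < k) (-1) ^+ s (lift ord0 i) * x ^+ j (lift ord0 i) =
    x ^+ j ord0 * ((-1) ^+ s ord0 + x * w).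
  rewrite mulrDr [in RHS]mulrC; congr (_ + _).
  rewrite mulrA -exprSr mulr_sumr; apply: eq_bigr => a _.
  by rewrite mulrCA -exprD subnKC // jlt.
apply: mulf_neq0; first by rewrite expf_neq0 // gt_eqF.
apply: root_not_unit.
apply: integral_bigsum => a; apply/integral_sign/integral_exprn/root_integral.
Qed.

Lemma finite_lower_bound (T : finType) (f : T -> R) :
  exists2 e : R, 0 < e & forall t, f t != 0 -> e <= `|f t|.
Proof.
exists (\big[Num.min/1]_(t | f t != 0) `|f t|).
  by elim/big_ind : _ => // [a b a0 b0|t t0]; rewrite ?lt_min ?a0 ?normr_gt0.
by move=> t t0; rewrite (bigD1 t)//= ge_min lexx.
Qed.

(* When the lowest power is negligible against the highest it can be dropped;
   otherwise all gaps are bounded and only finitely many nonzero values arise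
   up to a power of [x]. *)
Lemma signed_sum_lb k : exists2 e : R, 0 < e &
  forall (j : 'I_k.+1 -> nat) (s : 'I_k.+1 -> bool),
    {homo j : a b / (a < b)%N} ->
    e * x ^+ (j ord_max) <= `|\sum_a (-1) ^+ (s a) * x ^+ (j a)|.
Proof.
elim: k => [|k [e e0 IH]].
  exists 1 => // j s _; rewrite big_ord1 mul1r normrM normr_sign mul1r.
  by rewrite (_ : ord_max = ord0) ?ler_norm//; apply/val_inj.
(* [G] bounds the gap between the extreme exponents when the lowest power exceeds [e / 2] times the
   highest. *)
have [G hG] : exists G, 2 / e <= x ^+ G.
  exact: expr_unbounded.
(* Exponents relative to the lowest one then range over 0 to [G], so the normalised sums form a
   finite family. *)
have [eta eta0 hfin] := finite_lower_bound
   (T := ({ffun 'I_k.+2 -> 'I_G.+1} * {ffun 'I_k.+2 -> bool})%type)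
   (fun t => \sum_a (-1) ^+ (t.2 a) * x ^+ (t.1 a)).
(* [e / 2] serves the case of a negligible lowest term, [eta / x ^+ G] that of bounded gaps. *)
exists (Num.min (e / 2) (eta / x ^+ G)).
  by rewrite lt_min !divr_gt0 // exprn_gt0.
move=> j s jlt.
have jle (a b : 'I_k.+2) : (a <= b)%N -> (j a <= j b)%N.
  by rewrite leq_eqVlt => /orP[/eqP/val_inj->//|/jlt/ltnW].
have X0 m : 0 < x ^+ m by rewrite exprn_gt0.
have [small|big] := leP (x ^+ j ord0) (e / 2 * x ^+ j ord_max).
  apply: (@le_trans _ _ (e / 2 * x ^+ j ord_max)).
    by rewrite ler_pM2r // ge_min lexx.
  rewrite big_ord_recl addrC.
  set S := \sum_(i < k.+1) _; set u := _ * x ^+ j ord0.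
  have uE : `|u| = x ^+ j ord0 by rewrite normrM normr_sign mul1r gtr0_norm.
  have : e * x ^+ j ord_max <= `|S|.
    have := IH (j \o lift ord0) (s \o lift ord0).
    rewrite /= (_ : lift ord0 ord_max = ord_max); last exact/val_inj.
    by apply=> a b ab; apply: jlt; rewrite !lift0 ltnS.
  have := lerB_normD S u; rewrite uE; lra.
have gap : (j ord_max - j ord0 <= G)%N.
  rewrite leqNgt; apply/negP => gG.
  have : x ^+ G <= x ^+ (j ord_max - j ord0) by apply: ler_weXn2l; [exact: ltW|exact: ltnW].
  move/(le_trans hG); rewrite ler_pdivrMr //.
  have -> : x ^+ (j ord_max - j ord0) = x ^+ j ord_max / x ^+ j ord0.
    by rewrite -[in RHS](subnK (jle ord0 ord_max _)) // exprD mulfK ?gt_eqF.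
  rewrite mulrAC ler_pdivlMr // => h.
  by move: big; lra.
have gapa a : (j a - j ord0 < G.+1)%N.
  by rewrite ltnS (leq_trans _ gap) // leq_sub2r // jle // -ltnS ltn_ord.
have SE : \sum_a (-1) ^+ s a * x ^+ j a =
   x ^+ j ord0 * \sum_a (-1) ^+ s a * x ^+ (j a - j ord0).
  rewrite mulr_sumr; apply: eq_bigr => a _.
  by rewrite mulrCA -exprD subnKC // jle.
have := hfin ([ffun a => Ordinal (gapa a)], [ffun a => s a]) => /=.
under eq_bigr => a _ do rewrite !ffunE /=.
have : \sum_a (-1) ^+ s a * x ^+ j a != 0 by exact: signed_sum_neq0.
rewrite SE mulf_eq0 negb_or => /andP[_ /[swap] h /h {}h].
rewrite normrM (gtr0_norm (X0 _)).
apply: (@le_trans _ _ (eta / x ^+ G * x ^+ j ord_max)).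
  by rewrite ler_pM2r // ge_min lexx orbT.
apply: (@le_trans _ _ (x ^+ j ord0 * eta)); last by rewrite ler_pM2l.
rewrite mulrAC ler_pdivrMr // (mulrC (x ^+ j ord0)) -mulrA ler_pM2l // -exprD.
by apply: ler_weXn2l; [exact: ltW|lia].
Qed.

End PowersOfRoot.

(** * Weyl's criterion for arcs *)

Lemma cosDn (R : realType) (a : R) (n : nat) : cos (a + 2 * pi * n%:R) = cos a.
Proof. 
rewrite (_ : 2 * pi * n%:R = (pi *+ 2) *+ n); last by rewrite mulr_natr mulr_natl.
by rewrite (periodicn (@cosD2pi R)).
Qed.

Lemma cosDz (R : realType) (a : R) (z : int) : cos (a + 2 * pi * z%:~R) = cos a.
Proof.
case: z => n; first exact: cosDn.
rewrite NegzE mulrNz mulrN -(cosDn (a - _) n.+1) -addrA addNr addr0 //.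
Qed.

(** Telescoping, from 2 sin v cos t = sin (t + v) - sin (t - v). *)
Lemma sum_cos_arith (R : realType) (M : nat) (u v : R) :
  2 * sin v * \sum_(m < M) cos (u + 2 * v * m%:R) =
  sin (u - v + 2 * v * M%:R) - sin (u - v).
Proof.
elim: M => [|M IH]; first by rewrite big_ord0 !mulr0 addr0 subrr.
rewrite big_ord_recr /= mulrDr IH.
have -> : u - v + 2 * v * M.+1%:R = (u + 2 * v * M%:R) + v.
  by rewrite -(natr1 M); ring.
have -> : u - v + 2 * v * M%:R = (u + 2 * v * M%:R) - v by ring.
by rewrite (sinD _ v) (sinB _ v); ring.
Qed.

(** With [v = pi h / M] the telescoped sines differ by [h] full turns and cancel, while [sin v] is
    nonzero because [0 < h < M]. *)
Lemma sum_cos_roots (R : realType) (M h : nat) (u : R) : (0 < h < M)%N ->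
  \sum_(m < M) cos (h%:R * (u + 2 * pi * (m%:R / M%:R))) = 0.
Proof.
move=> /andP[h0 hM].
have M1 : (0 < M)%N by apply: leq_trans hM.
have M0 : 0 < M%:R :> R by rewrite ltr0n.
pose v : R := pi * (h%:R / M%:R).
have sv : 0 < sin v.
  apply: sin_gt0_pi; rewrite mulr_gt0 ?pi_gt0 ?divr_gt0 ?ltr0n//=.
  by rewrite gtr_pMr ?pi_gt0// ltr_pdivrMr// mul1r ltr_nat.
have := sum_cos_arith M (h%:R * u) v.
have -> : 2 * v * M%:R = 2 * pi * h%:R.
  by rewrite /v; field; exact: lt0r_neq0.
rewrite -{1}[sin (_ + _)]cosBpihalf addrAC cosDn cosBpihalf subrr.
move/eqP; rewrite !mulf_eq0 pnatr_eq0 (gt_eqF sv) /= => /eqP S0; rewrite -[RHS]S0.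
by apply: eq_bigr => m _; congr cos; rewrite /v; ring.
Qed.

(** A cosine polynomial is kept as a list of pairs of a coefficient and a frequency. The induction
    uses 2 cos (h u) cos u = cos ((h + 1) u) + cos ((h - 1) u). *)
Lemma cos_kernel_expansion (R : realType) (N : nat) :
  exists s : seq (R * nat), all (fun t => t.2 <= N)%N s /\
  forall u, ((1 + cos u) / 2) ^+ N = \sum_(t <- s) t.1 * cos (t.2%:R * u).
Proof.
elim: N => [|N [s [sN IH]]].
  exists [:: (1, 0%N)]; split => // u.
  by rewrite big_seq1 /= mul0r cos0 mulr1 expr0.
exists ([seq (t.1 / 2, t.2) | t <- s] ++ [seq (t.1 / 4, t.2.+1) | t <- s] ++
        (* The frequency -1 that arises from 0 is replaced by 1, since cosine is even. *)
        [seq (t.1 / 4, if t.2 is k.+1 then k else 1%N) | t <- s]).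
split.
  rewrite !all_cat !all_map; apply/and3P; split;
    apply: sub_all sN => -[c [|h]] //= hN; lia.
move=> u; rewrite exprS IH !big_cat !big_map /= mulr_sumr -!big_split /=.
apply: eq_bigr => -[c [|h]] _ /=; first by rewrite !mul0r cos0 !mul1r; lra.
have -> : h.+2%:R * u = h.+1%:R * u + u by rewrite -(natr1 h.+1); ring.
have -> : h%:R * u = h.+1%:R * u - u by rewrite -(natr1 h); ring.
by rewrite cosD cosB; lra.
Qed.

(** Summing over a grid of [N + 1] points kills the frequencies 1 to [N], so the grid translates of
    the kernel add up to a constant. *)
Lemma sum_cos_kernel (R : realType) (N : nat) (s : seq (R * nat)) (u : R) :
  all (fun t => t.2 <= N)%N s ->
  \sum_(m < N.+1) \sum_(t <- s) t.1 * cos (t.2%:R * (u + 2 * pi * (m%:R / N.+1%:R)))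
  = N.+1%:R * \sum_(t <- s | t.2 == 0%N) t.1.
Proof.
move=> sN; rewrite exchange_big /= mulr_sumr [RHS]big_mkcond /=.
rewrite big_seq [RHS]big_seq; apply: eq_bigr => t /(allP sN) tN.
rewrite -mulr_sumr; case: eqP => [->|/eqP t0].
  under eq_bigr => m _ do rewrite mul0r cos0.
  by rewrite sumr_const card_ord mulrC.
by rewrite sum_cos_roots ?mulr0// lt0n t0 ltnS.
Qed.

Lemma cvg_bigsum (R : realType) (F : set_system nat) {FF : Filter F} (I : Type)
    (s : seq I) (P : pred I) (f : I -> nat -> R) (l : I -> R) :
  (forall i, P i -> f i n @[n --> F] --> l i) ->
  \sum_(i <- s | P i) f i n @[n --> F] --> \sum_(i <- s | P i) l i.
Proof.
move=> fl; elim: s => [|i s IH].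
  by rewrite big_nil; under eq_fun do rewrite big_nil; exact: cvg_cst.
rewrite big_cons; under eq_fun do rewrite big_cons.
by case: ifP => // Pi; apply: cvgD => //; exact: fl.
Qed.

(** This chooses the degree of the kernel, making both the total tail over the grid and the mesh
    small. With y = 1 - rho one has rho (1 + y) <= 1, and squaring Bernoulli's bound at exponent K
    gives rho^(2 K) <= 1 / (K y)^2. *)
Lemma natmul_geometric_small (R : realType) (rho c : R) : 0 <= rho < 1 -> 0 < c ->
  exists N, N.+1%:R * rho ^+ N <= c /\ 2 / N.+1%:R <= c.
Proof.
move=> /andP[rho0 rho1] c0.
pose y := 1 - rho; have y0 : 0 < y by rewrite subr_gt0.
pose K := (Num.truncn (3 / (c * y ^+ 2) + 1 / c)).+1.
have hK := ltW (truncnS_gt (3 / (c * y ^+ 2) + 1 / c)); rewrite -/K in hK.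
have K0 : 0 < K%:R :> R by rewrite ltr0n.
have cy0 : 0 < c * y ^+ 2 by rewrite mulr_gt0 // exprn_gt0.
have hK1 : 3 <= K%:R * (c * y ^+ 2).
  rewrite -ler_pdivrMr// (le_trans _ hK)// lerDl divr_ge0// ltW//.
have hK2 : 1 <= K%:R * c.
  by rewrite -ler_pdivrMr// (le_trans _ hK)// lerDr divr_ge0// ltW.
exists (2 * K)%N.
have NE : (2 * K).+1%:R = 2 * K%:R + 1 :> R by rewrite -natr1 natrM.
have Kge1 : 1 <= K%:R :> R by rewrite ler1n.
split; last first.
  rewrite NE ler_pdivrMr; last lra.
  by rewrite mulrDr mulr1 mulrCA (mulrC c); lra.
have h1 : rho ^+ (2 * K) * (1 + y) ^+ (2 * K) <= 1.
  by rewrite -exprMn exprn_ile1// /y; nra.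
have h2 : (K%:R * y) ^+ 2 <= (1 + y) ^+ (2 * K).
  rewrite mulnC exprM; apply: lerXn2r; rewrite ?nnegrE.
  - by rewrite mulr_ge0 // ltW.
  - by rewrite exprn_ge0 // addr_ge0 // ltW.
  - by apply: le_trans (bernoulli_ge K (ltW y0)); rewrite lerDr.
have Ky0 : 0 < (K%:R * y) ^+ 2 by rewrite exprn_gt0 // mulr_gt0.
have h3 : rho ^+ (2 * K) <= ((K%:R * y) ^+ 2)^-1.
  rewrite -[leRHS]mul1r ler_pdivlMr//; apply: le_trans h1.
  by rewrite ler_wpM2l// exprn_ge0.
rewrite NE; apply: (@le_trans _ _ (3 * K%:R * ((K%:R * y) ^+ 2)^-1)).
  by apply: ler_pM => //; [exact: exprn_ge0|lra].
rewrite ler_pdivrMr// (_ : c * _ = K%:R * (K%:R * (c * y ^+ 2))); last by ring.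
by rewrite mulrC ler_pM2l.
Qed.

Lemma card_ord_range (M m0 m1 : nat) :
  (#|[pred m : 'I_M | (m0 <= m < m1)%N]| <= m1 - m0)%N.
Proof.
rewrite -sum1_card; suff : (\sum_(m < M | (m0 <= m < m1)%N) 1 <= minn M m1 - m0)%N.
  by move=> /leq_trans; apply; lia.
elim: M => [|M IH]; first by rewrite big_ord0.
rewrite big_mkcond big_ord_recr -big_mkcond /=; move: IH; set S := bigop _ _ _.
case: ifP; lia.
Qed.

(** Cosine decreases on [0, pi]; when [|v|] exceeds 1/2, periodicity and evenness replace it by
    [1 - |v|]. *)
Lemma cos_le_gap (R : realType) (delta v : R) : 0 <= delta ->
  delta <= `|v| <= 1 - delta -> cos (2 * pi * v) <= cos (2 * pi * delta).
Proof.
move=> d0 /andP[dv v1].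
have p0 := pi_gt0 R.
have decr (t u : R) : 0 <= t -> t <= u -> u <= pi -> cos u <= cos t.
  move=> t0 tu up; have tI : t \in `[0, pi] by rewrite in_itv /= t0 (le_trans tu).
  have uI : u \in `[0, pi] by rewrite in_itv /= up (le_trans t0).
  by rewrite leNgt ltr_cos// -leNgt.
rewrite -(cos_norm (2 * pi * v)) normrM (ger0_norm (mulr_ge0 _ (ltW p0)))//.
have [vh|vh] := leP `|v| (1 / 2); first by apply: decr; nra.
rewrite -[cos (_ * `|v|)]cosN -(cosDn _ 1) mulr1.
have -> : - (2 * pi * `|v|) + 2 * pi = 2 * pi * (1 - `|v|) by ring.
by apply: decr; nra.
Qed.

(* Weyl's criterion: [(1 + cos) / 2] to the power [N], translated along the grid
   [m / (N + 1)], is a trigonometric partition of unity up to a constant, and the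
   translates centred near the arc majorise its indicator. *)
Lemma weyl_arc (R : realType) (T : nat -> finType) (w S : forall n, T n -> R)
    (P : forall n, pred (T n)) (a l e : R) :
  (forall n x, 0 <= w n x) ->
  (\forall n \near \oo, \sum_x w n x = 1) ->
  (forall h c, (0 < h)%N ->
     \sum_x w n x * cos (2 * pi * h%:R * S n x + c) @[n --> \oo] --> (0 : R)) ->
  0 <= l -> 0 < e ->
  (forall n x, P n x -> exists z : int, a <= S n x - z%:~R <= a + l) ->
  \forall n \near \oo, \sum_(x | P n x) w n x <= l + e.
Proof.
move=> w0 w1 hS l0 e0 hP.
have [l1|l1] := leP 1 l.
  near=> n; have wn : \sum_x w n x = 1 by near: n.
  apply: (@le_trans _ _ 1); last by rewrite (le_trans l1)// lerDl ltW.
  by rewrite -wn [leRHS](bigID (P n))/= lerDl sumr_ge0.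
(* Widening the arc by [delta] on both sides adds at most [e / 4] and keeps it shorter than one
   period. *)
pose delta := Num.min (e / 8) ((1 - l) / 4).
have d0 : 0 < delta by rewrite lt_min !divr_gt0// subr_gt0.
have d1 : delta <= e / 8 by rewrite ge_min lexx.
have d2 : delta <= (1 - l) / 4 by rewrite ge_min lexx orbT.
have p0 := pi_gt0 R.
pose rho := (1 + cos (2 * pi * delta)) / 2.
have rho01 : 0 <= rho < 1.
  have : cos (2 * pi * delta) < cos 0.
    by rewrite ltr_cos ?in_itv/=; try (apply/andP; split); nra.
  rewrite cos0 => c1; have := cos_geN1 (2 * pi * delta); rewrite /rho.
  by move=> ?; apply/andP; split; lra.
have [|N [hN1 hN2]] := natmul_geometric_small (c := e / 4) rho01; first by rewrite divr_gt0.
set M : R := N.+1%:R in hN1 hN2.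
have M0 : 0 < M by rewrite ltr0n.
have [s [sN sE]] := cos_kernel_expansion R N.
pose g u : R := ((1 + cos u) / 2) ^+ N.
have g0 u : 0 <= g u.
  by rewrite exprn_ge0// divr_ge0//; have := cos_geN1 u; lra.
pose A := \sum_(t <- s | t.2 == 0%N) t.1.
have gA u : \sum_(m < N.+1) g (u + 2 * pi * (m%:R / M)) = M * A.
  by rewrite -(sum_cos_kernel u sN); apply: eq_bigr => m _; exact: sE.
(* The kernel is 1 at 0, so the normalising constant is at least 1 and dividing by it does not
   enlarge errors. *)
have MA1 : 1 <= M * A.
  rewrite -(gA 0) (bigD1 ord0)//= mul0r mulr0 addr0 /g cos0.
  by rewrite (_ : (1 + 1) / 2 = 1 :> R) ?expr1n ?lerDl ?sumr_ge0//; lra.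
have MA0 : 0 < M * A by rewrite (lt_le_trans ltr01).
(* Moving the origin to [o] puts the arc at [(1 - l) / 2, (1 + l) / 2]. Its widening [lo, hi] stays
   inside the unit interval, so the grid indices [G] near it form one range without wrapping. *)
pose lo := (1 - l) / 2 - delta; pose hi := (1 + l) / 2 + delta.
pose m0 := Num.truncn (M * lo); pose m1 := (Num.truncn (M * hi)).+1.
pose o := a - (1 - l) / 2.
pose G := [pred m : 'I_N.+1 | (m0 <= m < m1)%N].
pose u n x : R := - (2 * pi * (S n x - o)).
pose F n x := \sum_(m in G) g (u n x + 2 * pi * (m%:R / M)).
have lo0 : 0 <= lo by rewrite /lo; lra.
have hi0 : 0 <= hi by rewrite /hi; lra.
(* A grid point outside [G] is at circular distance at least [delta] from the translated point. *)
have far n x (m : 'I_N.+1) : P n x -> m \notin G ->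
    g (u n x + 2 * pi * (m%:R / M)) <= rho ^+ N.
  move=> /hP[z /andP[az zl]] mG.
  pose v := m%:R / M - (S n x - z%:~R - o).
  have mM : m%:R / M * M = m%:R by rewrite divfK// gt_eqF.
  have m_ge0 : 0 <= m%:R / M by rewrite divr_ge0 // ltW.
  have m_lt1 : m%:R / M < 1 by rewrite ltr_pdivrMr// mul1r ltr_nat.
  have -> : u n x + 2 * pi * (m%:R / M) = 2 * pi * v + 2 * pi * (- z)%:~R.
    by rewrite /u /v rmorphN /=; ring.
  rewrite /g cosDz.
  suff cle : cos (2 * pi * v) <= cos (2 * pi * delta).
    have c1 := cos_geN1 (2 * pi * v); have c2 := cos_geN1 (2 * pi * delta).
    by apply: lerXn2r; rewrite ?nnegrE /rho; [lra|lra|rewrite ler_pM2r ?lerD2l//].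
  apply: cos_le_gap; first exact: ltW.
  pose y := S n x - z%:~R - a.
  have y0 : 0 <= y by rewrite subr_ge0.
  have yl : y <= l by rewrite lerBlDl.
  have vE : v = m%:R / M - y - (1 - l) / 2 by rewrite /v /o /y; ring.
  move: mG; rewrite inE negb_and -!ltnNge ltnS => /orP[mlt|mgt].
    have : m%:R / M < lo.
      rewrite ltr_pdivrMr// mulrC (lt_le_trans (y := m0%:R))// ?ltr_nat//.
      by have /andP[] := truncn_itv (mulr_ge0 (ltW M0) lo0).
    rewrite /lo {}vE {v}; move: (_ / M) m_ge0 y y0 yl d0 d2 => t t0 y y0 yl d0 d2 mlo.
    have v0 : t - y - (1 - l) / 2 < 0 by lra.
    by rewrite ltr0_norm//; apply/andP; split; lra.
  have : hi < m%:R / M.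
    rewrite ltr_pdivlMr// mulrC (lt_le_trans (truncnS_gt _))// ler_nat.
    exact: mgt.
  rewrite /hi {}vE {v}; move: (_ / M) m_lt1 y y0 yl d0 d2 => t t1 y y0 yl d0 d2 mhi.
  have v0 : 0 < t - y - (1 - l) / 2 by lra.
  by rewrite gtr0_norm//; apply/andP; split; lra.
have FP n x : P n x -> 1 <= F n x / (M * A) + e / 4.
  move=> Px; have := gA (u n x); rewrite (bigID (mem G))/= -/(F n x).
  set rest := \sum_(m | m \notin G) _ => FE.
  have restle : rest <= M * rho ^+ N.
    apply: (@le_trans _ _ (\sum_(m : 'I_N.+1) rho ^+ N)).
      rewrite /rest big_mkcond /=; apply: ler_sum => m _.
      case: ifPn => [mG|_]; first exact: far Px mG.
      by rewrite exprn_ge0//; case/andP: rho01.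
    by rewrite sumr_const card_ord /M mulr_natl.
  have : 1 = F n x / (M * A) + rest / (M * A).
    by rewrite -mulrDl FE divff// gt_eqF.
  move=> oneE; rewrite [leLHS]oneE lerD2l ler_pdivrMr//.
  apply: (le_trans restle); apply: (le_trans hN1).
  by apply: ler_peMr => //; rewrite ltW// divr_gt0.
have F0 n x : 0 <= F n x by rewrite sumr_ge0.
(* The widened arc has length at most [l + e / 4], and rounding at its two ends costs
   [2 / M <= e / 4]. *)
have cardG : #|G|%:R / M <= l + e / 2.
  rewrite ler_pdivrMr//.
  apply: (@le_trans _ _ (m1 - m0)%:R); first by rewrite ler_nat card_ord_range.
  have lohi : M * lo <= M * hi by rewrite ler_pM2l// /lo /hi; lra.
  have bnd : M * hi - M * lo + 2 <= (l + e / 2) * M.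
    move: hN2; rewrite ler_pdivrMr// /hi /lo => hN2.
    have dM : delta * M <= e / 8 * M by rewrite ler_pM2r.
    by nra.
  apply: le_trans bnd.
  have [m10|m01] := leqP m1 m0.
    by rewrite (eqP (_ : (m1 - m0)%N == 0%N)) ?subn_eq0//; lra.
  rewrite natrB; last exact: ltnW.
  have /andP[h1 _] := truncn_itv (mulr_ge0 (ltW M0) hi0).
  have h2 := truncnS_gt (M * lo).
  rewrite /m1 /m0; move: h1 h2; rewrite -!(natr1 (Num.truncn _)); lra.
(* By [hS], only the constant frequency of each translate survives in the limit. *)
have lim : (\sum_x w n x * F n x) / (M * A) @[n --> \oo] --> #|G|%:R / M.
  rewrite (_ : #|G|%:R / M = (\sum_(m in G) A) / (M * A)); last first.
    have A0 : A != 0 by apply/eqP => A0; move: MA0; rewrite A0 mulr0 ltxx.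
    by rewrite sumr_const -mulr_natl; field; rewrite A0 gt_eqF.
  apply: cvgMr_tmp.
  rewrite (_ : (fun n => _) = fun n => \sum_(m in G) \sum_(t <- s) t.1 *
      \sum_x w n x * cos (t.2%:R * (u n x + 2 * pi * (m%:R / M)))); last first.
    apply/funext => n; under eq_bigr => x _ do rewrite /F mulr_sumr.
    rewrite exchange_big /=; apply: eq_bigr => m _.
    under eq_bigr => x _ do rewrite /g sE mulr_sumr.
    rewrite exchange_big /=; apply: eq_bigr => t _; rewrite mulr_sumr.
    by apply: eq_bigr => x _; rewrite mulrCA.
  apply: cvg_bigsum => m _; rewrite /A [X in _ --> X]big_mkcond /=.
  apply: cvg_bigsum => -[c [|h]] _ /=.
    rewrite -[X in _ --> X]mulr1; apply: cvgMl_tmp.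
    apply: cvg_near_cst; near=> n.
    under eq_bigr => x _ do rewrite mul0r cos0 mulr1.
    by near: n.
  rewrite -[X in _ --> X](mulr0 c); apply: cvgMl_tmp.
  rewrite [X in X @ _ --> _](_ : _ = fun n => \sum_x w n x * cos (2 * pi *
    h.+1%:R * S n x + - (h.+1%:R * (2 * pi * o + 2 * pi * (m%:R / M))))).
    exact: hS.
  apply/funext => n; apply: eq_bigr => x _.
  by rewrite -[in LHS]cosN; congr (_ * cos _); rewrite /u; ring.
have limlt : \forall n \near \oo, (\sum_x w n x * F n x) / (M * A) < l + 3 / 4 * e.
  apply: (cvgr_lt _ lim); apply: (le_lt_trans cardG).
  rewrite ltrD2l mulrC ltr_pM2r//; lra.
near=> n.
have wn : \sum_x w n x = 1 by near: n.
have : (\sum_x w n x * F n x) / (M * A) < l + 3 / 4 * e.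
  by near: n.
have : \sum_(x | P n x) w n x <= (\sum_x w n x * F n x) / (M * A) + e / 4.
  have -> : e / 4 = \sum_x w n x * (e / 4) by rewrite -mulr_suml wn mul1r.
  rewrite mulr_suml -big_split big_mkcond /=.
  apply: ler_sum => x _; case: ifP => Px.
    rewrite -mulrA -mulrDr -[leLHS]mulr1 ler_wpM2l//; exact: FP.
  apply: addr_ge0; last by rewrite mulr_ge0// divr_ge0// ltW.
  by apply: divr_ge0; [exact: mulr_ge0|exact: ltW].
move: (\sum_(x | P n x) _) ((\sum_x w n x * F n x) / (M * A)) => y1 y2; clear -e0.
by lra.
Unshelve. all: by end_near.
Qed.

(** * Sums of independent bits modulo 1 *)

(** The partial products never increase, and infinitely many factors shrink them by at least the
    ratio [k]. *)
Lemma prod_le1_cvg0 (R : realType) (f : nat -> R) (k : R) :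
  (forall i, 0 <= f i <= 1) -> 0 <= k < 1 ->
  (forall m, exists2 i, (m <= i)%N & f i <= k) ->
  \prod_(i < n) f i @[n --> \oo] --> (0 : R).
Proof.
move=> f01 /andP[k0 k1] fk.
have p0 n : 0 <= \prod_(i < n) f i.
  by apply: prodr_ge0 => i _; case/andP: (f01 i).
have anti m n : (m <= n)%N -> \prod_(i < n) f i <= \prod_(i < m) f i.
  elim: n => [|n IH]; first by rewrite leqn0 => /eqP->.
  rewrite leq_eqVlt => /orP[/eqP->//|/IH h]; apply: le_trans h.
  rewrite big_ord_recr /=; apply: ler_piMr => //.
    exact: p0.
  by have /andP[] := f01 n.
have small t : exists n, \prod_(i < n) f i <= k ^+ t.
  elim: t => [|t [n IH]]; first by exists 0%N; rewrite big_ord0.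
  have [i ni fi] := fk n; exists i.+1.
  rewrite big_ord_recr exprSr /=; have /andP[fi0 _] := f01 i.
  by apply: ler_pM => //; [exact: p0|exact: le_trans (anti _ _ ni) IH].
apply/cvgrPdist_lt => e e0.
have : k ^+ t @[t --> \oo] --> (0 : R) by apply: cvg_expr; rewrite ger0_norm//.
move=> /cvgrPdist_lt /(_ e e0)[t _ /(_ t (leqnn t))] /=.
rewrite sub0r normrN ger0_norm ?exprn_ge0// => kt.
have [n hn] := small t; near=> m.
rewrite sub0r normrN ger0_norm; last exact: p0.
apply: le_lt_trans kt; apply: le_trans hn.
by apply: anti; near: m; exact: nbhs_infty_ge.
Unshelve. all: by end_near.
Qed.

Section UnitCircle.
Variable R : realType.

Let cis (t : R) : R[i] := (cos t +i* sin t)%C.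
Let sqn (z : R[i]) : R := complex.Re z ^+ 2 + complex.Im z ^+ 2.

Let cisD a b : cis (a + b) = cis a * cis b.
Proof.
by rewrite /cis cosD sinD [sin a * _ + _]addrC.
Qed.

Let sqnM z1 z2 : sqn (z1 * z2) = sqn z1 * sqn z2.
Proof. by case: z1 z2 => [a b] [c d]; rewrite /sqn /=; ring. Qed.

Let sqn_prod (I : finType) (F : I -> R[i]) : sqn (\prod_i F i) = \prod_i sqn (F i).
Proof.
by apply: (big_morph sqn sqnM); rewrite /sqn /= expr1n expr0n /= addr0.
Qed.

Let cis_sum (I : finType) (F : I -> R) : cis (\sum_i F i) = \prod_i cis (F i).
Proof. by apply: (big_morph cis cisD); rewrite /cis cos0 sin0. Qed.

(** By independence the sum is the real part of a product of one-bit complex sums times a phase; the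
    right side is the squared modulus of that product. *)
Lemma weighted_cos_sum n (v : 'I_n -> bool -> R) (phi : 'I_n -> R) (c : R) :
  (\sum_(x : {ffun 'I_n -> bool})
     (\prod_i v i (x i)) * cos (\sum_i (x i)%:R * phi i + c)) ^+ 2 <=
  \prod_i ((v i false + v i true * cos (phi i)) ^+ 2 + (v i true * sin (phi i)) ^+ 2).
Proof.
pose F i (b : bool) : R[i] := (v i b)%:C%C * cis (b%:R * phi i).
pose z := (\prod_i \sum_b F i b) * cis c.
have zE : z = \sum_(x : {ffun 'I_n -> bool})
    (\prod_i v i (x i))%:C%C * cis (\sum_i (x i)%:R * phi i + c).
  rewrite /z bigA_distr_bigA mulr_suml; apply: eq_bigr => x _.
  by rewrite /F big_split /= cisD cis_sum rmorph_prod mulrA.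
have -> : \sum_(x : {ffun 'I_n -> bool})
     (\prod_i v i (x i)) * cos (\sum_i (x i)%:R * phi i + c) = complex.Re z.
  rewrite zE raddf_sum /=; apply: eq_bigr => x _.
  by rewrite /= mul0r subr0.
apply: (@le_trans _ _ (sqn z)); first by rewrite /sqn lerDl sqr_ge0.
rewrite /z sqnM sqn_prod /cis {2}/sqn /= cos2Dsin2 mulr1.
apply: ler_prod => i _; rewrite addr_ge0 ?sqr_ge0//=.
rewrite big_bool /F /= mul0r mul1r /cis cos0 sin0 /sqn /=.
rewrite [leLHS](_ : _ = (v i false + v i true * cos (phi i)) ^+ 2 + (v i true * sin (phi i)) ^+ 2) ?lexx //.
by ring.
Qed.

End UnitCircle.

Section Doubling.
Variable R : realType.
(** [s] vanishes exactly at the integers, and in terms of t = s / 2 doubling is the logistic map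
    sending t to 4 t (1 - t). *)
Let s (y : R) : R := 1 - cos (2 * pi * y).

Let s_ge0 y : 0 <= s y. Proof. by rewrite subr_ge0 cos_le1. Qed.

Let s_le2 y : s y <= 2.
Proof. by rewrite /s; have := cos_geN1 (2 * pi * y); lra. Qed.

Let s_double y : s (2 * y) = 2 * s y * (2 - s y).
Proof.
rewrite /s (_ : 2 * pi * (2 * y) = (2 * pi * y) *+ 2) ?cos_mulr2n; last by ring.
by ring.
Qed.

Let s_eq0 y : s y = 0 -> exists z : int, y = z%:~R.
Proof.
move=> sy; exists (Num.floor y).
have /andP[f0 f1] := floor_itv y; move: f1; rewrite intrD => f1.
pose f := y - (Num.floor y)%:~R.
have : s y = s f by rewrite /s /f -(cosDz (2 * pi * (y - _)) (Num.floor y)) -mulrDr subrK.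
rewrite sy => /esym; rewrite /s (_ : 2 * pi * f = (pi * f) *+ 2); last by ring.
rewrite cos_mulr2n cos2sin2 => h.
have [f_eq0|f_neq0] := eqVneq f 0.
  by apply/eqP; rewrite -subr_eq0 -/f f_eq0.
have : 0 < sin (pi * f).
  apply: sin_gt0_pi; have fgt0 : 0 < f by rewrite lt_def f_neq0 subr_ge0.
  rewrite mulr_gt0 ?pi_gt0//= gtr_pMr ?pi_gt0//.
  by rewrite /f ltrBlDl.
by move=> sf; exfalso; nra.
Qed.

(* Doubling at least triples [1 - cos (2 pi y)] while that is below 1/2, so
   it cannot stay small forever unless it vanishes. *)
Lemma doubling_orbit_far (p : nat) (y : R) : (0 < p)%N ->
  (forall m (z : int), 2 ^+ m * y != z%:~R) ->
  forall k0, exists2 k, (k0 <= k)%N &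
    cos (2 * pi * (2 ^+ (p * k) * y)) <= 1 - (2 * 4 ^+ p)^-1.
Proof.
move=> p0 yZ k0; apply: contrapT => none.
pose S m := s (2 ^+ m * y).
have SS m : S m.+1 = 2 * S m * (2 - S m).
  by rewrite /S exprS -mulrA s_double.
have S0 m : 0 < S m.
  rewrite lt_def s_ge0 andbT; apply/eqP => /s_eq0[z zE].
  by move: (yZ m z); rewrite zE eqxx.
have small k : (k0 <= k)%N -> S (p * k)%N < (2 * 4 ^+ p)^-1.
  move=> kk; rewrite ltNge; apply/negP => le; apply: none; exists k => //.
  by move: le; rewrite /S /s; lra.
have S4 m t : S (m + t)%N <= 4 ^+ t * S m.
  elim: t => [|t IH]; first by rewrite addn0 mul1r.
  rewrite addnS SS exprS -(mulrA 4).
  apply: (@le_trans _ _ (4 * S (m + t)%N)); last by rewrite ler_pM2l.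
  by have := S0 (m + t)%N; nra.
(* One doubling at most quadruples [S], and fewer than [p] doublings separate [m] from the last
   multiple of [p]; the threshold absorbs them. *)
have half m : (p * k0 <= m)%N -> S m <= 1 / 2.
  move=> hm; rewrite (divn_eq m p) mulnC.
  apply: le_trans (S4 _ _) _.
  have /small/ltW : (k0 <= m %/ p)%N by rewrite leq_divRL// mulnC.
  move/(ler_wpM2l (_ : 0 <= 4 ^+ (m %% p))) => h; apply: le_trans (h _) _.
    by rewrite exprn_ge0.
  have P4 : 0 < 4 ^+ p :> R by rewrite exprn_gt0.
  rewrite invfM mulrC -mulrA div1r ler_piMr// mulrC ler_pdivrMr// mul1r.
  by apply: ler_weXn2l; [lra|rewrite ltnW// ltn_mod].
pose m := (p * k0)%N.
have S3 t : 3 ^+ t * S m <= S (m + t)%N.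
  elim: t => [|t IH]; first by rewrite addn0 mul1r.
  rewrite addnS SS exprS -(mulrA 3).
  have h1 : S (m + t)%N <= 1 / 2 by apply: half; rewrite leq_addr.
  by have := S0 (m + t)%N; nra.
(* Tripling at every step would exceed the upper bound 2 on [s]. *)
have [t ht] := @expr_unbounded R 3 (3 / S m) ltac:(lra).
have := S3 t; have := s_le2 (2 ^+ (m + t) * y); rewrite -/(S _) => h1 h2.
move: ht; rewrite ler_pdivrMr//; lra.
Qed.

End Doubling.

(** Otherwise a^q 2^p = b^q, and comparing the exponents of 2 gives that q divides p, impossible for
    0 < p < q. *)
Lemma root_irrational (R : realType) (x : R) (p q : nat) (a b : int) :
  0 < x -> (0 < p < q)%N -> x ^+ q = 2 ^+ p -> 0 < a -> a%:~R * x != b%:~R :> R.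
Proof.
move=> x0 /andP[p0 pq] xq a0; apply/eqP => h.
have b0 : 0 < b by rewrite -(ltr0z R) -h mulr_gt0// ltr0z.
case: a a0 h => // a a0 h; case: b b0 h => // b b0 h.
have hN : (a ^ q * 2 ^ p = b ^ q)%N.
  apply/eqP; rewrite -(eqr_nat R) natrM !natrX -xq -exprMn.
  by move: h; rewrite /= => ->.
have := congr1 (logn 2) hN.
rewrite lognM ?expn_gt0 ?a0 //; last by rewrite orbC; lia.
rewrite pfactorK // (lognX _ a) (lognX _ b) => hq.
have : (q %| p)%N.
  have : (q %| q * logn 2 a + p)%N by rewrite hq dvdn_mulr.
  by rewrite dvdn_addr// dvdn_mulr.
by move/dvdn_leq => /(_ p0); rewrite leqNgt pq.
Qed.

(** Equal ceilings confine [S] modulo 1 to an arc of length [1 - tau], different ones to an arc of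
    length [tau]. [weyl_arc] bounds both weights from above, and since they sum to 1 both bounds are
    sharp in the limit. *)
Lemma weyl_ceil_ge0 (R : realType) (T : nat -> finType) (w S : forall n, T n -> R)
    (tau : R) :
  (forall n x, 0 <= w n x) ->
  (forall n, \sum_x w n x = 1) ->
  (forall h c, (0 < h)%N ->
     \sum_x w n x * cos (2 * pi * h%:R * S n x + c) @[n --> \oo] --> (0 : R)) ->
  0 <= tau < 1 ->
  \sum_(x | Num.ceil (S n x + tau) == Num.ceil (S n x)) w n x @[n --> \oo]
    --> 1 - tau.
Proof.
move=> w0 w1 hS /andP[t0 t1].
apply/cvgrPdist_le => e e0.
have up : \forall n \near \oo,
    \sum_(x | Num.ceil (S n x + tau) == Num.ceil (S n x)) w n x <= (1 - tau) + e.
  apply: (@weyl_arc _ _ w S _ 0) => //; [exact: nearW|by rewrite subr_ge0 ltW|].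
  move=> n x /eqP cE; exists (Num.ceil (S n x) - 1).
  have /andP[a1 _] := ceil_itv (S n x); have /andP[_] := ceil_itv (S n x + tau).
  by move: a1; rewrite cE rmorphB /= => a1 a2; apply/andP; split; lra.
have dn : \forall n \near \oo,
    \sum_(x | Num.ceil (S n x + tau) != Num.ceil (S n x)) w n x <= tau + e.
  apply: (@weyl_arc _ _ w S _ (- tau)) => //; first exact: nearW.
  move=> n x cE; exists (Num.ceil (S n x)).
  have /andP[a1 a2] := ceil_itv (S n x); rewrite addNr subr_le0 a2 andbT.
  rewrite leNgt; apply: contra cE => lt; rewrite ceil_eq.
  by move: a1; rewrite rmorphB /= => a1; apply/andP; split; lra.
near=> n.
have h1 : \sum_(x | Num.ceil (S n x + tau) == Num.ceil (S n x)) w n x <= (1 - tau) + e.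
  by near: n.
have h2 : \sum_(x | Num.ceil (S n x + tau) != Num.ceil (S n x)) w n x <= tau + e.
  by near: n.
have := w1 n.
rewrite (bigID (fun x => Num.ceil (S n x + tau) == Num.ceil (S n x))) /=.
move: (\sum_(x | _ == _) _) (\sum_(x | _ != _) _) h1 h2 => y z h1 h2 yz.
by rewrite ler_norml; apply/andP; split; lra.
Unshelve. all: by end_near.
Qed.

(** A negative shift is a positive one seen from [S + tau]; the added constant is absorbed in the
    phase [c]. *)
Lemma weyl_ceil (R : realType) (T : nat -> finType) (w S : forall n, T n -> R)
    (tau : R) :
  (forall n x, 0 <= w n x) ->
  (forall n, \sum_x w n x = 1) ->
  (forall h c, (0 < h)%N ->
     \sum_x w n x * cos (2 * pi * h%:R * S n x + c) @[n --> \oo] --> (0 : R)) ->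
  `|tau| < 1 ->
  \sum_(x | Num.ceil (S n x + tau) == Num.ceil (S n x)) w n x @[n --> \oo]
    --> 1 - `|tau|.
Proof.
move=> w0 w1 hS t1; have [t0|t0] := leP 0 tau.
  by rewrite ger0_norm// in t1 *; apply: weyl_ceil_ge0 => //; rewrite t0.
have := @weyl_ceil_ge0 R T w (fun n x => S n x + tau) `|tau| w0 w1.
rewrite normr_ge0 t1 => /(_ _ isT) lim.
rewrite [X in X @ _ --> _](_ : _ = fun n => \sum_(x | Num.ceil (S n x + tau + `|tau|)
   == Num.ceil (S n x + tau)) w n x).
  apply: lim => h c h0.
  rewrite [X in X @ _ --> _](_ : _ = fun n => \sum_x w n x *
     cos (2 * pi * h%:R * S n x + (2 * pi * h%:R * tau + c))); first exact: hS.
  by apply/funext => n; apply: eq_bigr => x _; congr (_ * cos _); ring.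
apply/funext => n; apply: eq_bigl => x.
by rewrite ltr0_norm// addrK eq_sym.
Qed.

(** The law of one bit: a point mass where [f] freezes it, a fair coin elsewhere. As [f] lives on
    all naturals, it serves words of every length. *)
Definition bit_weight (R : realType) (f : nat -> option bool) (i : nat) (b : bool) : R :=
  if f i is Some c then (b == c)%:R else 2^-1.

Definition word_weight (R : realType) (f : nat -> option bool) (n : nat)
  (x : {ffun 'I_n -> bool}) : R := \prod_(i < n) bit_weight R f i (x i).

Lemma word_weight_ge0 (R : realType) f n (x : {ffun 'I_n -> bool}) :
  0 <= word_weight R f x.
Proof. by apply: prodr_ge0 => i _; rewrite /bit_weight; case: (f i). Qed.

Lemma sum_word_weight (R : realType) f n :
  \sum_(x : {ffun 'I_n -> bool}) word_weight R f x = 1.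
Proof.
rewrite -(bigA_distr_bigA (fun i : 'I_n => bit_weight R f i)) big1// => i _.
by rewrite big_bool /bit_weight; case: (f i) => [[]|] /=; rewrite ?addr0 ?add0r//; lra.
Qed.

(** In the squared modulus a frozen bit contributes the factor 1 and a fair bit (1 + cos phi) / 2.
    At index q k the angle is 2 pi times 2^(p k) h (y - 1), on a doubling orbit of an irrational
    number, so infinitely many factors stay below a constant less than 1. *)
Lemma word_weight_cos_cvg0 (R : realType) (y : R) (p q N : nat)
    (f : nat -> option bool) (h : nat) (c : R) :
  1 < y -> (0 < p < q)%N -> y ^+ q = 2 ^+ p ->
  (forall i, (N <= i)%N -> f i = None) -> (0 < h)%N ->
  \sum_(x : {ffun 'I_n -> bool}) word_weight R f x *
    cos (2 * pi * h%:R * (\sum_(i < n) (x i)%:R * ((y - 1) * y ^+ i)) + c)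
  @[n --> \oo] --> (0 : R).
Proof.
move=> y1 /andP[p0 pq] yq fN h0.
pose phi i : R := 2 * pi * (h%:R * (y - 1) * y ^+ i).
pose rho i : R := (bit_weight R f i false + bit_weight R f i true * cos (phi i)) ^+ 2
  + (bit_weight R f i true * sin (phi i)) ^+ 2.
have rhoE i : rho i = if f i is Some _ then 1 else (1 + cos (phi i)) / 2.
  rewrite /rho /bit_weight; have := cos2Dsin2 (phi i).
  by case: (f i) => [[]|] /= cs; [nra|nra|move: cs; rewrite !expr2; lra].
have rho01 i : 0 <= rho i <= 1.
  rewrite rhoE; case: (f i) => [_|]; first by rewrite ler01 lexx.
  have := cos_geN1 (phi i); have := cos_le1 (phi i) => ? ?.
  by apply/andP; split; lra.
have P4 : 0 < (2 * 4 ^+ p)^-1 :> R by rewrite invr_gt0 mulr_gt0// exprn_gt0.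
have P4' : (2 * 4 ^+ p)^-1 <= 1 :> R.
  rewrite invf_le1 ?mulr_gt0 ?exprn_gt0//.
  have : 1 <= 4 ^+ p :> R by rewrite exprn_ege1//; lra.
  lra.
have lim : \prod_(i < n) rho i @[n --> \oo] --> (0 : R).
  apply: (@prod_le1_cvg0 _ rho (1 - (2 * 4 ^+ p)^-1 / 2)) => //.
    by apply/andP; split; lra.
  move=> m.
  have [k km hk] : exists2 k, (maxn m N <= k)%N &
      cos (2 * pi * (2 ^+ (p * k) * (h%:R * (y - 1)))) <= 1 - (2 * 4 ^+ p)^-1.
    apply: doubling_orbit_far => // t z; apply/eqP => zE.
    have a0 : 0 < 2 ^+ t * h%:Z by rewrite mulr_gt0 ?exprn_gt0 ?ltz_nat.
    have pq' : (0 < p < q)%N by rewrite p0.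
    have /eqP := root_irrational (z + 2 ^+ t * h%:Z) (lt_trans ltr01 y1) pq' yq a0.
    by apply; rewrite rmorphD /= -zE rmorphM /= rmorphXn /= -pmulrn; ring.
  have kqk : (k <= q * k)%N by rewrite leq_pmull// (leq_trans _ pq).
  move: km; rewrite geq_max => /andP[mk Nk].
  exists (q * k)%N; first exact: leq_trans kqk.
  rewrite rhoE fN; last exact: leq_trans kqk.
  rewrite /phi exprM yq -exprM (mulrC _ (2 ^+ _)); lra.
apply/cvgrPdist_lt => e e0.
have e2 : 0 < e ^+ 2 by rewrite exprn_gt0.
move/cvgrPdist_lt : lim => /(_ _ e2) lim.
near=> n.
have pn : `|0 - \prod_(i < n) rho i| < e ^+ 2 by near: n.
rewrite sub0r normrN -(@ltr_pXn2r _ 2) ?nnegrE//; last exact: ltW.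
rewrite real_normK ?num_real//.
apply: (le_lt_trans _ pn); rewrite sub0r normrN ger0_norm; last first.
  by apply: prodr_ge0 => i _; case/andP : (rho01 i).
have := @weighted_cos_sum R n (fun i => bit_weight R f i) (fun i => phi i) c.
rewrite /rho; apply: le_trans; rewrite le_eqVlt; apply/orP; left; apply/eqP.
congr (_ ^+ 2); apply: eq_bigr => x _; congr (_ * cos (_ + _)).
by rewrite mulr_sumr; apply: eq_bigr => i _; rewrite /phi; ring.
Unshelve. all: by end_near.
Qed.

(** * Flipping bits of a word *)

Definition increasing_idx (d N : nat) (j : {ffun 'I_d -> 'I_N}) : bool :=
  [forall a : 'I_d, forall b : 'I_d, (a < b)%N ==> (j a < j b)%N].

Lemma increasing_idxP (d N : nat) (j : {ffun 'I_d -> 'I_N}) :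
  reflect {homo j : a b / (a < b)%N} (increasing_idx j).
Proof.
apply: (iffP forallP) => [h a b ab|h a]; last by apply/forallP => b; apply/implyP/h.
by have /forallP/(_ b)/implyP/(_ ab) := h a.
Qed.

Lemma homo_ltn_inj (d : nat) (j : 'I_d -> nat) :
  {homo j : a b / (a < b)%N} -> injective j.
Proof.
move=> jlt a b jab; apply/val_inj/eqP; rewrite eqn_leq.
by apply/andP; split; rewrite leqNgt; apply/negP => /jlt; rewrite jab ltnn.
Qed.

(* Positions are numbered from 0 here, so [j a] is the index [j_a - 1] of the paper. *)
Definition flip_at (d n : nat) (j : 'I_d -> nat) (x : {ffun 'I_n -> bool}) :
  {ffun 'I_n -> bool} := [ffun i => x i (+) [exists a, j a == i]].

Definition diff_seq (n : nat) (x y : {ffun 'I_n -> bool}) : seq nat :=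
  [seq val i | i <- enum [set i | x i != y i]%SET].

Lemma diff_seq_sorted n (x y : {ffun 'I_n -> bool}) : sorted ltn (diff_seq x y).
Proof.
rewrite /diff_seq sorted_map /fintype.enum_mem -enumT sorted_filter//.
  by move=> a b c; exact: ltn_trans.
by rewrite -sorted_map val_enum_ord iota_ltn_sorted.
Qed.

Lemma size_diff_seq n (x y : {ffun 'I_n -> bool}) : size (diff_seq x y) = hamming x y.
Proof. by rewrite size_map -cardE. Qed.

Lemma mem_diff_seq n (x y : {ffun 'I_n -> bool}) (i : 'I_n) :
  (val i \in diff_seq x y) = (x i != y i).
Proof. by rewrite mem_map ?mem_enum ?inE//; exact: val_inj. Qed.

Lemma mem_diff_seq_lt n (x y : {ffun 'I_n -> bool}) k :
  k \in diff_seq x y -> (k < n)%N.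
Proof. by case/mapP => i _ ->; exact: ltn_ord. Qed.

Lemma flip_atE (d n : nat) (j : 'I_d -> nat) (x : {ffun 'I_n -> bool}) i :
  (x i != flip_at j x i) = [exists a, j a == i].
Proof. by rewrite ffunE; case: (x i); case: [exists _, _]. Qed.

(** Together with [diff_seq_flip_at], this identifies the words at distance [d] from [x] with the
    increasing [d]-tuples of positions. *)
Lemma flip_at_diff_seq n d (x y : {ffun 'I_n -> bool}) : hamming x y = d ->
  flip_at (fun a : 'I_d => nth 0 (diff_seq x y) a) x = y.
Proof.
move=> hd; apply/ffunP => i; rewrite ffunE.
have -> : [exists a : 'I_d, nth 0 (diff_seq x y) a == i] = (x i != y i).
  rewrite -mem_diff_seq; apply/existsP/idP => [[a /eqP ia]|].
    rewrite -[val i]/(nat_of_ord i) -ia; apply: mem_nth.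
    by rewrite size_diff_seq hd.
  move=> ie; have := ie; rewrite -index_mem size_diff_seq hd => il.
  by exists (Ordinal il); rewrite /= nth_index.
by case: (x i); case: (y i).
Qed.

Lemma diff_seq_flip_at n d (j : 'I_d -> nat) (x : {ffun 'I_n -> bool}) :
  {homo j : a b / (a < b)%N} -> (forall a, j a < n)%N ->
  diff_seq x (flip_at j x) = [seq j a | a <- enum 'I_d].
Proof.
move=> jlt jn; apply: (irr_sorted_eq ltn_trans ltnn) => //.
- exact: diff_seq_sorted.
- rewrite sorted_map; apply: (@sub_sorted _ (relpre val ltn)) => [a b /jlt//|].
  by rewrite -sorted_map val_enum_ord iota_ltn_sorted.
move=> k; apply/idP/mapP => [kd|[a _ ->]].
  have kn := mem_diff_seq_lt kd.
  move: kd; rewrite -[k]/(val (Ordinal kn)) mem_diff_seq flip_atE.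
  by case/existsP => a /eqP ja; exists a; rewrite ?mem_enum.
rewrite -[j a]/(val (Ordinal (jn a))) mem_diff_seq flip_atE.
by apply/existsP; exists a.
Qed.

Lemma nth_diff_seq_homo n d (x y : {ffun 'I_n -> bool}) : hamming x y = d ->
  {homo (fun a : 'I_d => nth 0 (diff_seq x y) a) : a b / (a < b)%N}.
Proof.
move=> hd a b ab.
by apply: (sorted_ltn_nth ltn_trans _ (diff_seq_sorted x y)) => //;
  rewrite inE size_diff_seq hd.
Qed.

Section Ell.
Variables (R : realType) (r : R).
Let y : R := 2 `^ r.

Lemma powR2_expr k : 2 `^ (k%:R * r) = y ^+ k :> R.
Proof. by rewrite mulrC powRrM powR_mulrn// powR_ge0. Qed.

(** Passes from exponents counted from 1 to positions counted from 0, where bit k weighs (y - 1)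
    y^k. *)
Lemma one_sub_powR2N k : (1 - 2 `^ (- r)) * y ^+ k.+1 = (y - 1) * y ^+ k :> R.
Proof.
have y0 : 0 < y by rewrite powR_gt0.
by rewrite powRN -/y exprS; field; rewrite gt_eqF.
Qed.

Lemma oac_ellE n (x : {ffun 'I_n -> bool}) :
  oac_ell r x = \sum_(i < n) (x i)%:R * ((y - 1) * y ^+ i).
Proof.
rewrite /oac_ell mulr_sumr; apply: eq_bigr => i _.
by rewrite powR2_expr mulrCA one_sub_powR2N.
Qed.

Lemma shift_tau_succ d (j : 'I_d -> nat) (b : {ffun 'I_d -> bool}) :
  shift_tau r [ffun a => (j a).+1] b =
  \sum_a (1 - 2 * (b a)%:R) * ((y - 1) * y ^+ (j a)).
Proof.
rewrite /shift_tau mulr_sumr; apply: eq_bigr => a _.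
by rewrite ffunE (mulrC r) powR2_expr mulrCA one_sub_powR2N.
Qed.

(** Flipping the bit x_i adds 1 - 2 x_i to it, and injectivity of [j] counts each flipped position
    once. *)
Lemma oac_ell_flip_at n d (j : 'I_d -> 'I_n) (x : {ffun 'I_n -> bool}) :
  injective j ->
  oac_ell r (flip_at (fun a => j a : nat) x) =
  oac_ell r x + shift_tau r [ffun a => (j a).+1] [ffun a => x (j a)].
Proof.
move=> jinj; rewrite (shift_tau_succ (fun a => j a : nat)) !oac_ellE.
have -> : \sum_a (1 - 2 * ([ffun a => x (j a)] a)%:R) * ((y - 1) * y ^+ (j a)) =
   \sum_(i in [set j a | a in 'I_d]%SET) (1 - 2 * (x i)%:R) * ((y - 1) * y ^+ i).
  rewrite big_imset /=; last by move=> a b _ _; exact: jinj.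
  by apply: eq_bigr => a _; rewrite ffunE.
rewrite [X in _ = _ + X]big_mkcond -big_split /=; apply: eq_bigr => i _.
rewrite ffunE; have -> : [exists a, (j a : nat) == i] = (i \in [set j a | a in 'I_d]%SET).
  apply/existsP/imsetP => [[a /eqP ja]|[a _ ->]]; last by exists a.
  by exists a => //; apply/val_inj.
by case: ifP => _; case: (x i) => /=; ring.
Qed.

End Ell.

(** Both points lie in one half-open interval of length 1. *)
Lemma ceil_eq_lt1 (R : realType) (s t : R) :
  Num.ceil (s + t) = Num.ceil s -> `|t| < 1.
Proof.
move=> cE; have /andP[a1 a2] := ceil_itv s; have /andP[b1 b2] := ceil_itv (s + t).
move: a1 a2 b1 b2; rewrite cE rmorphB /= => a1 a2 b1 b2.
by rewrite ltr_norml; apply/andP; split; lra.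
Qed.

Lemma pos_increasing_succ d (j : 'I_d -> nat) :
  {homo j : a b / (a < b)%N} -> pos_increasing d [ffun a => (j a).+1].
Proof. by move=> jlt; split => [a|a b /jlt]; rewrite !ffunE. Qed.

(** A word at distance [d] in the coset of [x] has bounded flipped positions by hypothesis, so the
    count over words becomes a sum over a set of tuples that does not depend on [n]. *)
Lemma hdsE (R : realType) (r : R) (d n N : nat) : (N.+1 <= n)%N ->
  (forall j b, pos_increasing d j -> `|shift_tau r j b| < 1 ->
     forall a, (j a <= N.+1)%N) ->
  hds r d n = \sum_(j : {ffun 'I_d -> 'I_N.+1} | increasing_idx j)
    \sum_(x : {ffun 'I_n -> bool})
      2 ^- n * (oac_m r (flip_at (fun a => j a : nat) x) == oac_m r x)%:R.
Proof.
move=> Nn bnd; rewrite /hds mulr_sumr exchange_big /=.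
apply: eq_bigr => x _; rewrite -mulr_sumr; congr (_ * _).
pose P y := (oac_m r y == oac_m r x) && (hamming x y == d).
(* The default value of [inord] is never reached on [P], by [nthN]. *)
pose h' y : {ffun 'I_d -> 'I_N.+1} := [ffun a : 'I_d => inord (nth 0 (diff_seq x y) a)].
have nthN y : P y -> forall a : 'I_d, (nth 0 (diff_seq x y) a < N.+1)%N.
  move=> /andP[/eqP my /eqP hd].
  have nthn (a : 'I_d) : (nth 0 (diff_seq x y) a < n)%N.
    by apply: mem_diff_seq_lt (mem_nth _ _); rewrite size_diff_seq hd.
  pose j0 a : 'I_n := Ordinal (nthn a).
  have j0lt : {homo (fun a => j0 a : nat) : a b / (a < b)%N}.
    exact: nth_diff_seq_homo hd.
  have j0inj : injective j0.
    by move=> a b ab; apply: (homo_ltn_inj j0lt); rewrite ab.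
  have := oac_ell_flip_at r x j0inj; rewrite (flip_at_diff_seq hd).
  set b := [ffun a => x (j0 a)] => ellE.
  have t1 : `|shift_tau r [ffun a => (j0 a).+1] b| < 1.
    by apply: (@ceil_eq_lt1 _ (oac_ell r x)); rewrite -ellE.
  move=> a; have := bnd _ _ (pos_increasing_succ j0lt) t1 a.
  by rewrite ffunE.
have h'E y a : P y -> h' y a = nth 0 (diff_seq x y) a :> nat.
  by move=> Py; rewrite ffunE inordK// nthN.
rewrite /oac_k cardsE -sum1_card natr_sum.
rewrite (reindex_onto (fun j : {ffun 'I_d -> 'I_N.+1} => flip_at (fun a => j a : nat) x) h')
  => [|y Py]; last first.
  have Py' : P y by [].
  have /andP[_ /eqP hd] := Py'.
  rewrite -[RHS](flip_at_diff_seq hd); apply/ffunP => i; rewrite !ffunE.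
  by congr (_ (+) _); apply: eq_existsb => a; rewrite h'E.
rewrite [RHS]big_mkcond [LHS]big_mkcond /=; apply: eq_bigr => j _.
set y := flip_at _ x.
(* A tuple read off a difference list is increasing, so all others drop out. *)
have [incr|nincr] := boolP (increasing_idx j); last first.
  case: ifP => // /andP[Py /eqP jE]; case/negP: nincr; apply/increasing_idxP => a b ab.
  rewrite -jE !h'E//; apply: nth_diff_seq_homo => //.
  by case/andP: (Py : P y) => _ /eqP.
have jlt := increasing_idxP _ incr.
have jn a : (j a < n)%N by rewrite (leq_trans _ Nn).
have dE := diff_seq_flip_at x jlt jn.
have hd : hamming x y = d by rewrite -size_diff_seq dE size_map size_enum_ord.
have -> : h' y = j.
  apply/ffunP => a; rewrite ffunE /y dE (nth_map a) ?size_enum_ord//.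
  by rewrite nth_ord_enum inord_val.
rewrite eqxx andbT unfold_in /= hd eqxx andbT.
by case: (_ == _).
Qed.

Definition fixed_bits d (j : 'I_d -> nat) (b : 'I_d -> bool) (i : nat) : option bool :=
  omap b [pick a | j a == i].

Lemma fixed_bits_some d (j : 'I_d -> nat) (b : 'I_d -> bool) a : injective j ->
  fixed_bits j b (j a) = Some (b a).
Proof.
move=> jinj; rewrite /fixed_bits; case: pickP => [a' /eqP/jinj ->//|/(_ a)].
by rewrite eqxx.
Qed.

(** Each frozen bit trades a factor 1/2 for 1, which gives the uniform law conditioned on the bits
    at [j] being [b]. *)
Lemma word_weight_fixed_bits (R : realType) d n (j : 'I_d -> 'I_n)
    (b : {ffun 'I_d -> bool}) (x : {ffun 'I_n -> bool}) : injective j ->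
  word_weight R (fixed_bits (fun a => j a : nat) b) x =
  if [ffun a => x (j a)] == b then 2 ^+ d * 2 ^- n else 0.
Proof.
move=> jinj; set f := fixed_bits _ _.
have jinj' : injective (fun a => j a : nat) by move=> a a' /val_inj/jinj.
case: eqP => [xb|/eqP]; last first.
  move=> xb; have [a xa] : exists a, x (j a) != b a.
    apply/existsP; rewrite -negb_forall; apply: contra xb => /forallP h.
    by apply/eqP/ffunP => a; rewrite ffunE; apply/eqP.
  rewrite /word_weight (bigD1 (j a))//= /bit_weight /f fixed_bits_some//.
  by rewrite (negbTE xa) mul0r.
transitivity (\prod_(i < n) (2^-1 * (if i \in [set j a | a in 'I_d]%SET then 2 else 1)) : R).
  apply: eq_bigr => i _; case: imsetP => [[a _ ->]|none].
    rewrite /bit_weight /f fixed_bits_some// -xb ffunE eqxx.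
    by rewrite mulVf.
  rewrite mulr1 /bit_weight /f /fixed_bits; case: pickP => //= a /eqP ja.
  by case: none; exists a => //; apply/val_inj.
rewrite big_split /= prodr_const card_ord -big_mkcond prodr_const.
by rewrite card_imset// card_ord mulrC exprVn.
Qed.

(** Conditioning on the original values [b] of the flipped bits, an event of probability 2^-d, makes
    the shift a constant. *)
Lemma flip_sum (R : realType) (r : R) (d n N : nat) (j : {ffun 'I_d -> 'I_N.+1}) :
  (N.+1 <= n)%N -> increasing_idx j ->
  \sum_(x : {ffun 'I_n -> bool})
      2 ^- n * (oac_m r (flip_at (fun a => j a : nat) x) == oac_m r x)%:R =
  \sum_(b : {ffun 'I_d -> bool}) 2 ^- d *
    \sum_(x : {ffun 'I_n -> bool} | Num.ceil (oac_ell r x + shift_tau r [ffun a => (j a).+1] b)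
        == Num.ceil (oac_ell r x)) word_weight R (fixed_bits (fun a => j a : nat) b) x.
Proof.
move=> Nn /increasing_idxP jlt.
pose jn a : 'I_n := widen_ord Nn (j a).
have jninj : injective jn.
  by move=> a a' /(congr1 val) /=; exact: (homo_ltn_inj jlt).
rewrite (partition_big (fun x : {ffun 'I_n -> bool} => [ffun a => x (jn a)] : {ffun 'I_d -> bool}) xpredT)//=.
apply: eq_bigr => b _.
rewrite mulr_sumr [RHS]big_mkcond [LHS]big_mkcond /=; apply: eq_bigr => x _.
rewrite (@word_weight_fixed_bits R d n jn)//.
case: eqP => [xb|_]; last by rewrite mulr0 if_same.
rewrite /oac_m (@oac_ell_flip_at R r n d jn)// xb.
case: eqP => _; last by rewrite mulr0.
by rewrite mulr1 mulKf// expf_neq0.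
Qed.

(** * The limit *)

(** The summand vanishes off finitely many tuples, whose entries are lowered by one to become
    positions. *)
Lemma esum_pos_increasing (R : realType) (d N : nat) (f : {ffun 'I_d -> nat} -> R) :
  (forall j, pos_increasing d j -> 0 <= f j) ->
  (forall j, pos_increasing d j -> f j != 0 -> forall a, (j a <= N.+1)%N) ->
  (\esum_(j in pos_increasing d) (f j)%:E =
   (\sum_(j : {ffun 'I_d -> 'I_N.+1} | increasing_idx j) f [ffun a => (j a).+1])%:E)%E.
Proof.
move=> f0 fN.
pose A := [set` [pred j : {ffun 'I_d -> 'I_N.+1} | increasing_idx j]].
pose e (j : {ffun 'I_d -> 'I_N.+1}) : {ffun 'I_d -> nat} := [ffun a => (j a).+1].
have einj : set_inj A e.
  move=> j j' _ _ /ffunP ejj; apply/ffunP => a; apply/val_inj.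
  by have := ejj a; rewrite !ffunE => -[].
have eA : e @` A `<=` pos_increasing d.
  by move=> _ [j /increasing_idxP jlt <-]; exact: (pos_increasing_succ jlt).
transitivity (\esum_(j in pos_increasing d) if j \in e @` A then (f j)%:E else 0%E)%E.
  apply: eq_esum => j jp; case: ifPn => // /negP jA.
  have [-> //|fj] := eqVneq (f j) 0; exfalso; apply: jA; rewrite inE.
  have jN := fN j jp fj; case: (jp) => jpos jlt.
  exists [ffun a => inord (j a).-1]; last first.
    by apply/ffunP => a; rewrite !ffunE inordK ?prednK// ltnS -ltnS prednK.
  apply/increasing_idxP => a b /jlt ab; rewrite !ffunE !inordK; last 2 first.
  - by rewrite ltnS -ltnS prednK.
  - by rewrite ltnS -ltnS prednK.
  by rewrite -ltnS !prednK.
rewrite -esum_mkcondr setIC setIidl// esum_image// esum_fset//; last 2 first.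
- exact: finite_finset.
- by move=> j; rewrite inE => jA; rewrite lee_fin f0//; apply: eA; exists j.
rewrite /A -(@bigfs _ _ _ _ (index_enum _)) ?index_enum_uniq//; first by rewrite sumEFin.
by move=> j _; rewrite mem_index_enum.
Qed.

Lemma shift_tau_signed_sum (R : realType) (r : R) d (j : 'I_d -> nat) (b : {ffun 'I_d -> bool}) :
  shift_tau r [ffun a => (j a).+1] b =
  (2 `^ r - 1) * \sum_a (-1) ^+ (b a) * (2 `^ r) ^+ (j a).
Proof.
rewrite shift_tau_succ mulr_sumr; apply: eq_bigr => a _.
rewrite mulrCA; congr (_ * _).
by case: (b a) => /=; lra.
Qed.

Section Rational.
Variables (R : realType) (r : R) (p q : nat).
Hypotheses (p_gt0 : (0 < p)%N) (q_gt0 : (0 < q)%N) (r_gt0 : 0 < r) (qr : q%:R * r = p%:R).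

Lemma powR2_root : (2 `^ r) ^+ q = 2 ^+ p :> R.
Proof. by rewrite -powR2_expr qr powR_mulrn. Qed.

Lemma powR2_gt1 : 1 < 2 `^ r :> R.
Proof.
have : 1 `^ r < 2 `^ r :> R.
  by apply: gt0_ltr_powR => //; rewrite ?nnegrE ?ltr1n.
by rewrite powR1.
Qed.

(** With y = 2^r, [signed_sum_lb] bounds |tau| below by (y - 1) e y^(j_d - 1), which limits the
    largest index and hence all of them. *)
Lemma shift_tau_lt1_bounded d : (0 < d)%N -> exists N, forall (j : {ffun 'I_d -> nat}) b,
  pos_increasing d j -> `|shift_tau r j b| < 1 -> forall a, (j a <= N.+1)%N.
Proof.
case: d => // d _.
have y1 := powR2_gt1.
have [e e0 he] := signed_sum_lb y1 p_gt0 q_gt0 powR2_root d.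
have [N hN] := expr_unbounded ((2 `^ r - 1) * e)^-1 y1.
have ye0 : 0 < (2 `^ r - 1) * e by rewrite mulr_gt0// subr_gt0.
exists N => j b [jpos jlt] t1 a.
have jE : j = [ffun a => ((j a).-1).+1] by apply/ffunP => i; rewrite ffunE prednK.
have plt : {homo (fun a => (j a).-1) : a b / (a < b)%N}.
  by move=> i k /jlt h; rewrite -ltnS !prednK.
have := he _ b plt.
move: t1; rewrite {1}jE (shift_tau_signed_sum r (fun a => (j a).-1)) normrM.
rewrite gtr0_norm ?subr_gt0//; set s := `|_| => t1 hs.
have : (2 `^ r) ^+ (j ord_max).-1 < (2 `^ r) ^+ N :> R.
  apply: lt_le_trans hN; rewrite -[ltRHS]mulr1 -ltr_pdivrMl ?invr_gt0// invrK.
  apply: le_lt_trans t1; rewrite -mulrA ler_pM2l ?subr_gt0//.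
rewrite ltr_eXn2l// => jN; rewrite -(prednK (jpos a)) ltnS ltnW//.
apply: leq_ltn_trans jN.
have : (a <= @ord_max d)%N by exact: leq_ord.
by rewrite leq_eqVlt => /orP[/eqP/val_inj->//|/plt/ltnW].
Qed.

(** Here tau is a signed sum of powers of 2, hence an integer, and [signed_sum_neq0] with p = q = 1
    makes it nonzero. *)
Lemma shift_tau_rate1 d (j : 'I_d -> nat) b : r = 1 -> (0 < d)%N ->
  {homo j : a b / (a < b)%N} -> 1 <= `|shift_tau r [ffun a => (j a).+1] b|.
Proof.
case: d j b => // d j b r1 _ jlt.
rewrite shift_tau_signed_sum r1 powRr1// addrK mul1r.
have := @signed_sum_neq0 R 2 1 1 _ _ _ (erefl _) d j b jlt.
rewrite ltr1n => /(_ isT isT isT).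
have -> : \sum_a (-1) ^+ b a * 2 ^+ j a =
    (\sum_a (-1) ^+ b a * 2 ^+ j a : int)%:~R :> R.
  rewrite rmorph_sum; apply: eq_bigr => a _.
  by rewrite rmorphM /= rmorph_sign rmorphXn.
rewrite intr_eq0 -intr_norm ler1z.
by rewrite -normr_gt0 gtz0_ge1.
Qed.

(** If |tau| >= 1 the event is empty and the positive part is 0. Otherwise [shift_tau_rate1]
    excludes r = 1, so p < q and equidistribution applies. *)
Lemma cvg_flip_event d (j : 'I_d -> nat) (b : {ffun 'I_d -> bool}) (f : nat -> option bool)
    (N : nat) :
  r <= 1 -> (0 < d)%N -> {homo j : a b / (a < b)%N} ->
  (forall i, (N <= i)%N -> f i = None) ->
  \sum_(x : {ffun 'I_n -> bool} |
      Num.ceil (oac_ell r x + shift_tau r [ffun a => (j a).+1] b) == Num.ceil (oac_ell r x))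
    word_weight R f x @[n --> \oo]
  --> pos_part (1 - `|shift_tau r [ffun a => (j a).+1] b|).
Proof.
move=> r1 d0 jlt fN; set tau := shift_tau _ _ _.
have [t1|t1] := leP 1 `|tau|.
  rewrite /pos_part max_l ?subr_le0//.
  rewrite [X in X @ _ --> _](_ : _ = fun _ => 0); first exact: cvg_cst.
  apply/funext => n; apply: big1 => x /eqP /ceil_eq_lt1.
  by rewrite ltNge t1.
have rlt1 : r < 1.
  rewrite lt_neqAle r1 andbT; apply: contraTN t1 => /eqP re.
  by rewrite -leNgt; exact: shift_tau_rate1.
have pq : (p < q)%N.
  by rewrite -(ltr_nat R) -qr gtr_pMr// ltr0n.
rewrite /pos_part max_r ?subr_ge0 ?ltW//.
apply: (@weyl_ceil R (fun n => {ffun 'I_n -> bool}) (fun n x => word_weight R f x)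
  (fun n x => oac_ell r x)) => //.
- by move=> n x; exact: word_weight_ge0.
- by move=> n; exact: sum_word_weight.
move=> h c h0.
rewrite [X in X @ _ --> _](_ : _ = fun n => \sum_(x : {ffun 'I_n -> bool})
   word_weight R f x * cos (2 * pi * h%:R *
     (\sum_(i < n) (x i)%:R * ((2 `^ r - 1) * (2 `^ r) ^+ i)) + c)).
  apply: (@word_weight_cos_cvg0 R _ p q N) => //; first exact: powR2_gt1.
    by rewrite p_gt0.
  exact: powR2_root.
by apply/funext => n; apply: eq_bigr => x _; rewrite oac_ellE.
Qed.

Lemma cvg_hds d : r <= 1 -> (0 < d)%N ->
  ((hds r d n)%:E @[n --> \oo] -->
    ((2 ^- d)%R%:E * \sum_(b : {ffun 'I_d -> bool})
       \esum_(j in pos_increasing d)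
         (pos_part (1 - `|shift_tau r j b|)%R)%:E))%E.
Proof.
move=> r1 d0; have [N bnd] := shift_tau_lt1_bounded d0.
pose l (b : {ffun 'I_d -> bool}) (j : {ffun 'I_d -> 'I_N.+1}) : R :=
  pos_part (1 - `|shift_tau r [ffun a => (j a).+1] b|).
(* The bound on the indices makes the claimed limit a finite sum, so convergence can be checked term
   by term. *)
rewrite (_ : (_ * _)%E = (\sum_(j : {ffun 'I_d -> 'I_N.+1} | increasing_idx j)
   \sum_(b : {ffun 'I_d -> bool}) 2 ^- d * l b j)%:E); last first.
  rewrite exchange_big /=.
  under [X in _ = X%:E]eq_bigr => b _ do rewrite -mulr_sumr.
  rewrite -mulr_sumr EFinM -sumEFin; congr (_ * _)%E; apply: eq_bigr => b _.
  apply: esum_pos_increasing => j jp; first by rewrite /pos_part le_max lexx.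
  move=> ne; apply: (bnd j b) => //; rewrite ltNge; apply: contra ne => t1.
  by rewrite /pos_part max_l// subr_le0.
apply: cvg_EFin; first exact: nearW.
rewrite /comp /=.
(* Once [n] exceeds [N], the spectrum equals this finite sum exactly. *)
apply: (@cvg_trans _ ((fun n => \sum_(j : {ffun 'I_d -> 'I_N.+1} | increasing_idx j)
  \sum_(b : {ffun 'I_d -> bool}) 2 ^- d *
    \sum_(x : {ffun 'I_n -> bool} | Num.ceil (oac_ell r x + shift_tau r [ffun a => (j a).+1] b)
        == Num.ceil (oac_ell r x)) word_weight R (fixed_bits (fun a => j a : nat) b) x) @ \oo)).
  apply: near_eq_cvg; near=> n.
  have Nn : (N.+1 <= n)%N by near: n; exact: nbhs_infty_ge.
  by rewrite (hdsE Nn bnd); apply: eq_bigr => j ji; rewrite -flip_sum.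
apply: cvg_bigsum => j /increasing_idxP jlt.
apply: cvg_bigsum => b _; apply: cvgMl_tmp.
apply: (@cvg_flip_event d (fun a => j a : nat) b _ N.+1) => // i iN.
rewrite /fixed_bits; case: pickP => //= a /eqP ja.
by move: iN; rewrite -ja leqNgt ltn_ord.
Unshelve. all: by end_near.
Qed.

End Rational.

Theorem theoremV2 (R : realType) (r : R) (d : nat)
    (r_gt0 : 0 < r) (r_le1 : r <= 1) (d_gt0 : (0 < d)%N) :
  is_asymptotic_hds r d
    ((2 ^- d)%R%:E * \sum_(b : {ffun 'I_d -> bool})
       \esum_(j in pos_increasing d)
         (pos_part (1 - `|shift_tau r j b|)%R)%:E)%E.
Proof.
rewrite /is_asymptotic_hds.
(* An admissible length q > 0 writes r as a fraction p / q. *)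
have [[q q0 qr]|noq] := pselect (exists2 q : nat, (0 < q)%N & q%:R * r \is a Num.int).
  have /natrP[p pE] : q%:R * r \is a Num.nat by rewrite natrEint qr mulr_ge0// ltW.
  have p0 : (0 < p)%N by rewrite -(ltr_nat R) -pE mulr_gt0// ltr0n.
  by apply: cvg_within_filter; exact: cvg_hds p0 q0 r_gt0 pE _ r_le1 d_gt0.
(* The filter of the limit is then improper, hence finer than every filter. *)
move=> A _; apply: (@filterS _ \oo _ [set n : nat | (0 < n)%N]); last exact: nbhs_infty_gt.
by move=> n n0 nr; case: noq; exists n.
Qed.
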